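(* Let $\mathcal{S}$ be a unipotent numerical monoid in $G$. If $\leq$ is one of the three $\mathcal{S}$-orders $\leq_{\mathcal{S},r}$, $\leq_{\mathcal{S},l}$, $\leq_{\mathcal{S},t}$ on $G_{\mathbb{Z}}$, then the pair $(G(\mathbb{N}),\leq)$ is a locally finite poset (that is, every interval $[A,B]=\{C\in G(\mathbb{N})\mid A\leq C\leq B\}$ is finite).
   Context: Setting: $n$ is a positive integer, $\mathbf{U}(n,\mathbb{C})$ is the group of upper triangular unipotent $n\times n$ complex matrices, and $G$ is a (Zariski) closed subgroup of it. $G_{\mathbb{Z}}$ is the group of matrices in $G$ with integer entries, and $G(\mathbb{N})$ is the monoid of matrices in $G_{\mathbb{Z}}$ all of whose entries lie in $\mathbb{N}=\{0,1,2,\dots\}$. Standing assumptions: the monoid $G(\mathbb{N})$ is finitely generated and $G_{\mathbb{Z}}$ is its group completion. A unipotent numerical monoid in $G$ is a finitely generated submonoid $\mathcal{S}\subseteq G(\mathbb{N})$ (containing the identity matrix) such that $G(\mathbb{N})\setminus\mathcal{S}$ is finite. The $\mathcal{S}$-orders on $G_{\mathbb{Z}}$ are defined, for $A,B\in G_{\mathbb{Z}}$, by: $A\leq_{\mathcal{S},r}B\iff BA^{-1}\in\mathcal{S}$; $A\leq_{\mathcal{S},l}B\iff A^{-1}B\in\mathcal{S}$; $A\leq_{\mathcal{S},t}B\iff\{A^{-1}B,BA^{-1}\}\subseteq\mathcal{S}$. *)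

(* Defs.v *)
From mathcomp Require Import all_boot all_order all_algebra.
From mathcomp Require Import classical_sets cardinality reals.
From mathcomp Require Import complex.
From mathcomp Require mpoly.

Set Implicit Arguments.
Unset Strict Implicit.
Unset Printing Implicit Defensive.

Import GRing.Theory.
Local Open Scope classical_set_scope.
Local Open Scope ring_scope.

Section MatrixMonoids.
Variables (C : comUnitRingType) (n : nat).
Implicit Types (X Y : set 'M[C]_n) (A B : 'M[C]_n).

Definition unitriangular : set 'M[C]_n :=
  [set A | (forall i, A i i = 1) /\
           (forall i j : 'I_n, (j < i)%N -> A i j = 0)].

(* The n ^ 2 coordinates of a matrix are indexed through [mxvec]. *)
Definition zariski_closed X : Prop :=
  exists P : set (mpoly.mpoly (n * n) C),
    X = [set A | forall p, P p -> mpoly.meval (mxvec A 0) p = 0].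

Definition submonoid X : Prop :=
  X 1%:M /\ (forall A B, X A -> X B -> X (A *m B)).

Definition subgroup X : Prop :=
  [/\ submonoid X, (forall A, X A -> A \in unitmx)
    & forall A, X A -> X (invmx A)].

Definition finitely_generated X : Prop :=
  exists2 F : set 'M[C]_n, finite_set F & X = smallest submonoid F.

Definition integer_points X : set 'M[C]_n :=
  [set A | X A /\ forall i j, exists z : int, A i j = z%:~R].

Definition natural_points X : set 'M[C]_n :=
  [set A | integer_points X A /\ forall i j, exists k : nat, A i j = k%:R].

(* Only the restriction of [f] to [X] matters. *)
Definition monoid_hom_on (H : groupType) X (f : 'M[C]_n -> H) : Prop :=
  f 1%:M = 1%g /\
  (forall A B, X A -> X B -> f (A *m B) = (f A * f B)%g).

(* The universal property of the group completion, for the inclusion of the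
   monoid [X] into the group [Y]: every homomorphism from [X] to a group
   factors uniquely through [Y]. *)
Definition group_completion X Y : Prop :=
  [/\ submonoid X, subgroup Y, X `<=` Y
    & forall (H : groupType) (f : 'M[C]_n -> H), monoid_hom_on X f ->
        (exists2 g : 'M[C]_n -> H, monoid_hom_on Y g &
           forall A, X A -> g A = f A) /\
        (forall g1 g2 : 'M[C]_n -> H,
           monoid_hom_on Y g1 -> monoid_hom_on Y g2 ->
           (forall A, X A -> g1 A = f A) -> (forall A, X A -> g2 A = f A) ->
           forall A, Y A -> g1 A = g2 A)].

Definition unipotent_numerical_monoid (G S : set 'M[C]_n) : Prop :=
  [/\ submonoid S, S `<=` natural_points G, finitely_generated S
    & finite_set (natural_points G `\` S)].

Definition order_r (S : set 'M[C]_n) A B : Prop := S (B *m invmx A).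
Definition order_l (S : set 'M[C]_n) A B : Prop := S (invmx A *m B).
Definition order_t (S : set 'M[C]_n) A B : Prop :=
  [set invmx A *m B; B *m invmx A] `<=` S.

End MatrixMonoids.

Definition poset_on (T : Type) (X : set T) (le : T -> T -> Prop) : Prop :=
  [/\ forall a, X a -> le a a,
      forall a b, X a -> X b -> le a b -> le b a -> a = b
    & forall a b c, X a -> X b -> X c -> le a b -> le b c -> le a c].

Definition locally_finite_poset_on (T : Type) (X : set T)
    (le : T -> T -> Prop) : Prop :=
  poset_on X le /\
  forall a b, X a -> X b -> finite_set [set c | [/\ X c, le a c & le c b]].

(* Main.v *)
Require Import Defs.
From mathcomp Require Import all_boot all_order all_algebra.
From mathcomp Require Import classical_sets cardinality reals.
From mathcomp Require Import complex.

Import Order.TTheory GRing.Theory Num.Theory.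

Local Open Scope classical_set_scope.
Local Open Scope ring_scope.

(**
  If B = N C with N and C unipotent with entries in the naturals, then
  B_ij = N_ii C_ij + (nonnegative terms) >= C_ij, and symmetrically on the other
  side. Hence every element of [A, B] is a natural matrix entrywise below B, and
  there are finitely many of those. The same bound applied to N N' = 1 shows that
  the identity is the only unit of S, which is antisymmetry.
*)

(** A [numDomainType] suffices because only sums of nonnegative terms occur; this covers [R[i]],
    whose order is partial. *)
Lemma le_entry_mulmxr {C : numDomainType} {m n : nat}
    (A : 'M[C]_(m, n)) (B : 'M[C]_n) (i : 'I_m) (j : 'I_n) :
  (forall k l, 0 <= A k l) -> (forall k l, 0 <= B k l) -> B j j = 1 ->
  A i j <= (A *m B) i j.
Proof.
move=> A_ge0 B_ge0 Bjj; rewrite mxE (bigD1 j) //= Bjj mulr1 lerDl.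
by apply: sumr_ge0 => k _; apply: mulr_ge0.
Qed.

Lemma le_entry_mulmxl {C : numDomainType} {m n : nat}
    (A : 'M[C]_m) (B : 'M[C]_(m, n)) (i : 'I_m) (j : 'I_n) :
  (forall k l, 0 <= A k l) -> (forall k l, 0 <= B k l) -> A i i = 1 ->
  B i j <= (A *m B) i j.
Proof.
move=> A_ge0 B_ge0 Aii; rewrite mxE (bigD1 i) //= Aii mul1r lerDl.
by apply: sumr_ge0 => k _; apply: mulr_ge0.
Qed.

(** With [N] the largest entry of [B], every such matrix has its entries in {0, ..., N}, so it is
    the image of a matrix over the finite type ['I_N.+1]. *)
Lemma finite_natural_matrices_le {C : numDomainType} {m n : nat}
    (B : 'M[C]_(m, n)) :
  (forall i j, exists k : nat, B i j = k%:R) ->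
  finite_set [set A : 'M[C]_(m, n) |
    (forall i j, exists k : nat, A i j = k%:R) /\ forall i j, A i j <= B i j].
Proof.
move=> /(fun h => fin_all_exists (fun i => fin_all_exists (h i)))[b Bb].
pose N := (\max_i \max_j b i j)%N.
pose F (M : 'M['I_N.+1]_(m, n)) : 'M[C]_(m, n) := map_mx (fun k : 'I_N.+1 => k%:R) M.
apply: (@sub_finite_set _ _ (F @` setT)); last first.
  by apply: finite_image; apply: finite_finset.
move=> A [/(fun h => fin_all_exists (fun i => fin_all_exists (h i)))[a Aa] leAB].
have aN i j : (a i j < N.+1)%N.
  (* The embedding of the naturals in [C] reflects the order, so the bound in [C] becomes one in
     [nat]. *)
  rewrite ltnS (@leq_trans (b i j)) //; first by rewrite -(ler_nat C) -Aa -Bb.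
  by apply: leq_trans (leq_bigmax i); exact: leq_bigmax.
exists (\matrix_(i, j) Ordinal (aN i j)) => //.
by apply/matrixP => i j; rewrite !mxE Aa.
Qed.

Section NaturalPoints.
Context {C : numDomainType} {n : nat} {G : set 'M[C]_n}.
Hypothesis G_unipotent : G `<=` @unitriangular _ n.
Implicit Types A B : 'M[C]_n.

Lemma natural_points_ge0 A : natural_points G A -> forall i j, 0 <= A i j.
Proof. by move=> [_ A_nat] i j; have [k ->] := A_nat i j. Qed.

Lemma natural_points_diag A : natural_points G A -> forall i, A i i = 1.
Proof. by move=> [[/G_unipotent[]]]. Qed.

Lemma natural_points_mulmx_eq1 A B :
  natural_points G A -> natural_points G B -> A *m B = 1%:M -> A = 1%:M.
Proof.
move=> GA GB AB; apply/matrixP => i j; rewrite mxE.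
have [<-|ij] := eqVneq i j; first by rewrite natural_points_diag.
(* Off the diagonal, the entry of [A] is squeezed between 0 and the entry of [A *m B], which is
   0. *)
apply/le_anti; rewrite natural_points_ge0 // andbT.
have := @le_entry_mulmxr _ _ _ A B i j (natural_points_ge0 _ GA)
  (natural_points_ge0 _ GB) (natural_points_diag _ GB j).
by rewrite AB mxE (negbTE ij).
Qed.

Lemma finite_natural_points_le B : natural_points G B ->
  finite_set [set A | natural_points G A /\ forall i j, A i j <= B i j].
Proof.
move=> [_ /finite_natural_matrices_le]; apply: sub_finite_set.
by move=> A [[_ A_nat] leAB].
Qed.

Context {S : set 'M[C]_n}.
Hypothesis G_subgroup : subgroup G.
Hypothesis S_submonoid : submonoid S.
Hypothesis S_natural : S `<=` natural_points G.

(** Since [invmx] returns its argument on a non-invertible matrix, the cancellations below depend on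
    this fact. *)
Lemma natural_points_unit A : natural_points G A -> A \in unitmx.
Proof. by case: G_subgroup => _ GU _ [[/GU]]. Qed.

Lemma order_r_locally_finite :
  locally_finite_poset_on (natural_points G) (order_r S).
Proof.
have [S1 SM] := S_submonoid.
split; first split.
- by move=> a /natural_points_unit ua; rewrite /order_r mulmxV.
- move=> a b /natural_points_unit ua /natural_points_unit ub.
  move=> /S_natural Sba /S_natural Sab.
  (* The two quotients lie in [S] and are inverse to each other, hence trivial. *)
  have ba1 : b *m invmx a = 1%:M.
    by apply: natural_points_mulmx_eq1 Sba Sab _; rewrite mulmxA mulmxKV ?mulmxV.
  by rewrite -(mulmxKV ua b) ba1 mul1mx.
- move=> a b c _ /natural_points_unit ub _ ab bc.
  (* The quotients telescope: (c b^-1)(b a^-1) = c a^-1. *)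
  by have := SM _ _ bc ab; rewrite mulmxA mulmxKV.
- move=> a b _ Gb; apply: sub_finite_set (finite_natural_points_le _ Gb).
  move=> c [Gc _ /S_natural Gbc]; split=> // i j.
  (* Writing b = (b c^-1) c makes [c] the right factor of a product of natural unipotent
     matrices. *)
  rewrite -(mulmxKV (natural_points_unit _ Gc) b).
  apply: le_entry_mulmxl; [exact: natural_points_ge0.. | exact: natural_points_diag].
Qed.

Lemma order_l_locally_finite :
  locally_finite_poset_on (natural_points G) (order_l S).
Proof.
have [S1 SM] := S_submonoid.
split; first split.
- by move=> a /natural_points_unit ua; rewrite /order_l mulVmx.
- move=> a b /natural_points_unit ua /natural_points_unit ub.
  move=> /S_natural Sab /S_natural Sba.
  have ab1 : invmx a *m b = 1%:M.
    by apply: natural_points_mulmx_eq1 Sab Sba _; rewrite mulmxA mulmxK ?mulVmx.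
  by rewrite -(mulKVmx ua b) ab1 mulmx1.
- move=> a b c _ /natural_points_unit ub _ ab bc.
  by have := SM _ _ ab bc; rewrite mulmxA mulmxK.
- move=> a b _ Gb; apply: sub_finite_set (finite_natural_points_le _ Gb).
  move=> c [Gc _ /S_natural Gcb]; split=> // i j.
  (* Here b = c (c^-1 b), so [c] is the left factor. *)
  rewrite -(mulKVmx (natural_points_unit _ Gc) b).
  apply: le_entry_mulmxr; [exact: natural_points_ge0.. | exact: natural_points_diag].
Qed.

Lemma order_tE A B : order_t S A B <-> order_l S A B /\ order_r S A B.
Proof.
split=> [tAB|[lAB rAB] _ [->|->]] //.
by split; apply: tAB; [left|right].
Qed.

(** As the intersection of the other two orders, this one inherits reflexivity and transitivity from
    both; being contained in [order_l S], it inherits antisymmetry, and its intervals lie inside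
    those of [order_l S]. *)
Lemma order_t_locally_finite :
  locally_finite_poset_on (natural_points G) (order_t S).
Proof.
have [[refl_l anti_l trans_l] fin_l] := order_l_locally_finite.
have [[refl_r _ trans_r] _] := order_r_locally_finite.
split; first split.
- by move=> a Ga; apply/order_tE; split; [exact: refl_l|exact: refl_r].
- by move=> a b Ga Gb /order_tE[+ _] /order_tE[+ _]; exact: anti_l.
- move=> a b c Ga Gb Gc /order_tE[lab rab] /order_tE[lbc rbc].
  by apply/order_tE; split; [exact: (trans_l a b c)|exact: (trans_r a b c)].
- move=> a b Ga Gb; apply: sub_finite_set (fin_l a b Ga Gb).
  by move=> c [Gc /order_tE[lac _] /order_tE[lcb _]].
Qed.

End NaturalPoints.

Theorem theorem1p2 (R : realType) (n : nat) (n_gt0 : (0 < n)%N)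
    (G : set 'M[R[i]]_n)
    (G_subgroup : subgroup G)
    (G_unipotent : G `<=` @unitriangular _ n)
    (G_closed : zariski_closed G)
    (GN_fg : finitely_generated (natural_points G))
    (GZ_completion : group_completion (natural_points G) (integer_points G))
    (S : set 'M[R[i]]_n)
    (S_numerical : unipotent_numerical_monoid G S)
    (le : 'M[R[i]]_n -> 'M[R[i]]_n -> Prop)
    (le_S : [\/ le = order_r S, le = order_l S | le = order_t S]) :
  locally_finite_poset_on (natural_points G) le.
Proof.
have [S_submonoid S_natural _ _] := S_numerical.
case: le_S => ->.
- exact: order_r_locally_finite.
- exact: order_l_locally_finite.
- exact: order_t_locally_finite.
Qed.
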